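(* Let $\mathbf{C}$ be a propositional Hilbert-type calculus. If $\mathbf{C}$ is undecidable (i.e. its set of theorems $\mathrm{Thm}(\mathbf{C})$ is undecidable), then $\mathbf{C}$ is not approximable.
   Context: A propositional language $\mathcal{L}$ has propositional variables $X_0,X_1,X_2,\dots$ and finitely many connectives of fixed finite arities. $\mathrm{Frm}(\mathcal{L})$ is the set of formulas. A propositional Hilbert-type calculus $\mathbf{C}$ in $\mathcal{L}$ is given by a finite set $A(\mathbf{C})\subseteq\mathrm{Frm}(\mathcal{L})$ of axioms and a finite set $R(\mathbf{C})$ of rules, each with premises $A_1,\dots,A_n$ and conclusion $A$ in $\mathrm{Frm}(\mathcal{L})$. A formula $F$ is a theorem of $\mathbf{C}$ if there is a finite sequence $F_1,\dots,F_s=F$ in which each $F_i$ is a substitution instance of an axiom, or follows from earlier members of the sequence by a substitution instance of a rule (the same substitution being applied to premises and conclusion). $\mathrm{Thm}(\mathbf{C})$ is the set of theorems. A finite-valued logic $\mathbf{M}$ over $\mathcal{L}$ is given by a finite nonempty set $V(\mathbf{M})$ of truth values, a set $V^+(\mathbf{M})\subseteq V(\mathbf{M})$ of designated truth values, and a truth function $V(\mathbf{M})^{n}\to V(\mathbf{M})$ for each $n$-ary connective. A valuation maps variables to $V(\mathbf{M})$ and is extended to all formulas via the truth functions; it satisfies $F$ if the value of $F$ is in $V^+(\mathbf{M})$. $\mathrm{Taut}(\mathbf{M})$ is the set of formulas satisfied by every valuation. $\mathbf{M}_1\unlhd\mathbf{M}_2$ iff $\mathrm{Taut}(\mathbf{M}_1)\subseteq\mathrm{Taut}(\mathbf{M}_2)$.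 $\mathbf{M}$ is a cover for $\mathbf{C}$ if all axioms in $A(\mathbf{C})$ are tautologies of $\mathbf{M}$ and, for every rule in $R(\mathbf{C})$, every valuation that satisfies the premises also satisfies the conclusion. A sequence $\langle\mathbf{M}_1,\mathbf{M}_2,\mathbf{M}_3,\dots\rangle$ of finite-valued logics such that (1) it is given by a recursive procedure, (2) $\mathbf{M}_i\unlhd\mathbf{M}_j$ iff $i\ge j$, and (3) each $\mathbf{M}_i$ is a cover for $\mathbf{C}$, is called a sequential approximation of $\mathbf{C}$ iff $\mathrm{Thm}(\mathbf{C})=\bigcap_{j}\mathrm{Taut}(\mathbf{M}_j)$. $\mathbf{C}$ is approximable if there is a sequential approximation of $\mathbf{C}$. *)

(* Defs.v *)
From HB Require Import structures.
From mathcomp Require Import all_boot.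

Set Implicit Arguments.
Unset Strict Implicit.
Unset Printing Implicit Defensive.

(* Kleene's total recursive functions: the least class containing zero,
   successor and the projections that is closed under composition, primitive
   recursion and minimization of regular functions (in rec_mu regularity of g
   is witnessed by f itself).  The defining equations are stated pointwise, so
   that the class is closed under extensional equality. *)
Inductive recursive : forall k, (k.-tuple nat -> nat) -> Prop :=
| rec_zero k (f : k.-tuple nat -> nat) :
    (forall v, f v = 0) -> recursive f
| rec_succ (f : 1.-tuple nat -> nat) :
    (forall v, f v = (tnth v ord0).+1) -> recursive f
| rec_proj k (i : 'I_k) (f : k.-tuple nat -> nat) :
    (forall v, f v = tnth v i) -> recursive f
| rec_comp k m (g : m.-tuple nat -> nat) (h : 'I_m -> k.-tuple nat -> nat)
    (f : k.-tuple nat -> nat) :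
    recursive g -> (forall i, recursive (h i)) ->
    (forall v, f v = g [tuple h i v | i < m]) -> recursive f
| rec_prim k (g : k.-tuple nat -> nat) (h : k.+2.-tuple nat -> nat)
    (f : k.+1.-tuple nat -> nat) :
    recursive g -> recursive h ->
    (forall v : k.-tuple nat, f [tuple of 0 :: v] = g v) ->
    (forall n (v : k.-tuple nat),
      f [tuple of n.+1 :: v] = h [tuple of n :: f [tuple of n :: v] :: v]) ->
    recursive f
| rec_mu k (g : k.+1.-tuple nat -> nat) (f : k.-tuple nat -> nat) :
    recursive g ->
    (forall v : k.-tuple nat, g [tuple of f v :: v] = 0 /\
      forall m, m < f v -> g [tuple of m :: v] <> 0) ->
    recursive f.

Definition recursive1 (f : nat -> nat) : Prop :=
  recursive (fun v : 1.-tuple nat => f (tnth v ord0)).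

Record language := Language {
  connective : finType;
  arity : connective -> nat
}.

Inductive formula (L : language) : Type :=
| Var of nat
| App (c : connective L) of {ffun 'I_(arity c) -> formula L}.

Arguments Var {L} n.
Arguments App {L} c a.

(* Goedel number; CodeSeq.code is the bijection seq nat -> nat with
   code [::] = 0 and code (n :: s) = 2 ^ n * (2 * code s + 1). *)
Fixpoint formula_code L (F : formula L) : nat :=
  match F with
  | Var n => CodeSeq.code [:: 0; n]
  | App c a => CodeSeq.code
      ((enum_rank c).+1 :: [seq formula_code (a i) | i <- enum 'I_(arity c)])
  end.

Lemma formula_ffun_ind L (P : formula L -> Prop) :
  (forall n, P (Var n)) ->
  (forall c (a : {ffun 'I_(arity c) -> formula L}),
     (forall i, P (a i)) -> P (App c a)) ->
  forall F, P F.
Proof.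
move=> PV PA; fix IH 1 => -[n|c a]; first exact: PV.
by apply: PA => i; apply: IH.
Qed.

Lemma formula_code_inj L : injective (@formula_code L).
Proof.
elim/formula_ffun_ind => [n|c a IH] [m|d b] /(can_inj CodeSeq.codeK) //=.
  by case=> ->.
case=> /ord_inj/enum_rank_inj def_d; case: d / def_d b => b.
move/eq_in_map=> eq_ab; congr App; apply/ffunP=> i.
by apply/IH/eq_ab; rewrite mem_enum.
Qed.

HB.instance Definition _ L :=
  Equality.copy (formula L) (inj_type (@formula_code_inj L)).

Definition decidable_set L (S : formula L -> Prop) : Prop :=
  exists2 f : nat -> nat, recursive1 f &
    forall F, S F <-> f (formula_code F) = 1.

Fixpoint subst L (sigma : nat -> formula L) (F : formula L) : formula L :=
  match F with
  | Var n => sigma n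
  | App c a => App c [ffun i => subst sigma (a i)]
  end.

(* Finite sets of axioms and rules are given by lists; a rule is the pair of
   its list of premises and its conclusion. *)
Record calculus (L : language) := Calculus {
  axioms : seq (formula L);
  rules : seq (seq (formula L) * formula L)
}.

Definition justified L (C : calculus L) (prev : seq (formula L))
    (F : formula L) : Prop :=
  (exists A sigma, A \in axioms C /\ F = subst sigma A) \/
  (exists r sigma, [/\ r \in rules C,
     forall A, A \in r.1 -> subst sigma A \in prev &
     F = subst sigma r.2]).

Definition derivation L (C : calculus L) (s : seq (formula L)) : Prop :=
  forall prev F next, s = prev ++ F :: next -> justified C prev F.

Definition Thm L (C : calculus L) (F : formula L) : Prop :=
  exists s, derivation C (rcons s F).

Definition undecidable L (C : calculus L) : Prop := ~ decidable_set (Thm C).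

Record logic (L : language) := Logic {
  value : finType;
  value_nonempty : 0 < #|value|;
  designated : {set value};
  truth : forall c : connective L, {ffun 'I_(arity c) -> value} -> value
}.

Fixpoint eval L (M : logic L) (v : nat -> value M) (F : formula L) : value M :=
  match F with
  | Var n => v n
  | App c a => truth [ffun i => eval v (a i)]
  end.

Definition satisfies L (M : logic L) (v : nat -> value M) (F : formula L) :=
  eval v F \in designated M.

Definition Taut L (M : logic L) (F : formula L) : Prop :=
  forall v : nat -> value M, satisfies v F.

Definition le_logic L (M1 M2 : logic L) : Prop :=
  forall F, Taut M1 F -> Taut M2 F.

Definition cover L (M : logic L) (C : calculus L) : Prop :=
  (forall A, A \in axioms C -> Taut M A) /\
  (forall r, r \in rules C -> forall v : nat -> value M,
     (forall A, A \in r.1 -> satisfies v A) -> satisfies v r.2).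

(* A finite-valued logic is coded, truth values being named by their ranks, by
   the number of truth values, the list of designated ones and, for each
   connective, the list of rows (value, arguments) of its truth table. *)
Definition row_code L (M : logic L) (c : connective L)
    (x : {ffun 'I_(arity c) -> value M}) : nat :=
  CodeSeq.code ((enum_rank (truth x) : nat) ::
    [seq (enum_rank (x i) : nat) | i <- enum 'I_(arity c)]).

Definition table_code L (M : logic L) (c : connective L) : nat :=
  CodeSeq.code
    [seq row_code x | x <- enum {: {ffun 'I_(arity c) -> value M}}].

Definition logic_code L (M : logic L) : nat :=
  CodeSeq.code
    [:: #|value M|;
        CodeSeq.code [seq (enum_rank x : nat) | x <- enum (designated M)];
        CodeSeq.code [seq table_code M c | c <- enum (connective L)]].

(* Sequences are indexed from 0. *)
Definition recursive_sequence L (M : nat -> logic L) : Prop :=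
  recursive1 (fun i => logic_code (M i)).

Definition sequential_approximation L (C : calculus L)
    (M : nat -> logic L) : Prop :=
  [/\ recursive_sequence M,
      forall i j, le_logic (M i) (M j) <-> j <= i,
      forall i, cover (M i) C &
      forall F, Thm C F <-> forall j, Taut (M j) F].

Definition approximable L (C : calculus L) : Prop :=
  exists M : nat -> logic L, sequential_approximation C M.

(* Main.v *)
Require Import Defs.
From mathcomp Require Import all_boot.
From Stdlib Require Import Classical.

(** An approximable calculus is decidable, by Post's argument that a set is
    recursive as soon as it and its complement are both recursively
    enumerable.

    The theorems of any calculus can be enumerated: a finite list of
    substitutions, applied in turn to all axioms and rules, produces finitely
    many theorems, and every theorem arises from a suitable list
    ([theorem_codes_sound], [theorem_codes_complete]).  If M is a sequential
    approximation of C, the nontheorems can be enumerated as well: a formula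
    that is not a theorem fails to be a tautology of some M_j, hence is refuted
    by an index j and the finitely many values taken by a valuation on the
    variables of the formula ([not_Taut_refutes], [refutes_not_Taut]); since
    the truth tables of M_j are computable from j, so is the test that a given
    pair refutes a given formula ([computable_refutes]).  An unbounded search
    for a witness of one kind or the other always succeeds, and the kind of the
    witness found decides the formula ([decidable_Thm]).

    Most of the work is to see that these tests are recursive in the sense of
    Kleene.  Recursive functions of one or two numbers are first shown to
    include the operations on the codes of lists: head, tail and cons.  A
    function between countable types is then called computable when some
    recursive function of one number tracks it on the codes.  Multi-argument
    functions become functions on products, so an expression with free
    variables x, y is handled as a function of the pair (x, y), and
    computability of an expression is checked by following its syntax.
    Formulas are handled through their codes, by recursion on the code: the
    entries of a list are smaller than its code, so that every number is a
    finite tree ([code_rec]). *)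

Set Implicit Arguments.
Unset Strict Implicit.
Unset Printing Implicit Defensive.

(** * Recursive functions of one, two and three arguments *)

Definition recursive2 (f : nat -> nat -> nat) : Prop :=
  recursive (fun v : 2.-tuple nat => f (nth 0 v 0) (nth 0 v 1)).

Definition recursive3 (f : nat -> nat -> nat -> nat) : Prop :=
  recursive (fun v : 3.-tuple nat => f (nth 0 v 0) (nth 0 v 1) (nth 0 v 2)).

(** The constructors of [recursive] take pointwise equations; composing with the
    projections transfers this freedom to the class as a whole. *)
Lemma eq_recursive k (f g : k.-tuple nat -> nat) :
  f =1 g -> recursive f -> recursive g.
Proof.
move=> eq_fg rec_f.
apply: (rec_comp rec_f (h := fun i v => tnth v i)) => [i|v].
  exact: (@rec_proj k i).
by rewrite -eq_fg; congr f; apply: eq_from_tnth => i; rewrite tnth_mktuple.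
Qed.

Lemma recursive_nth k i : recursive (fun v : k.-tuple nat => nth 0 v i).
Proof.
have [lt_ik|le_ki] := ltnP i k.
  by apply: (@rec_proj k (Ordinal lt_ik)) => v; rewrite (tnth_nth 0).
by apply: rec_zero => v; rewrite nth_default ?size_tuple.
Qed.

Lemma nth_mktuple_lt m (F : 'I_m -> nat) i (lt_im : i < m) :
  nth 0 [tuple F j | j < m] i = F (Ordinal lt_im).
Proof. by rewrite -[i]/(val (Ordinal lt_im)) -tnth_nth tnth_mktuple. Qed.

Lemma recursive_comp1 k f (g : k.-tuple nat -> nat) :
  recursive1 f -> recursive g -> recursive (fun v => f (g v)).
Proof.
move=> rec_f rec_g; apply: (rec_comp rec_f (h := fun _ => g)) => // v.
by rewrite tnth_mktuple.
Qed.

Lemma recursive_comp2 k f (g h : k.-tuple nat -> nat) :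
  recursive2 f -> recursive g -> recursive h ->
  recursive (fun v => f (g v) (h v)).
Proof.
move=> rec_f rec_g rec_h.
apply: (rec_comp rec_f (h := fun i => if val i is 0 then g else h)).
  by case=> [] [|i].
by move=> v; rewrite !nth_mktuple_lt.
Qed.

Lemma recursive1P f :
  recursive1 f <-> recursive (fun v : 1.-tuple nat => f (nth 0 v 0)).
Proof. by split; apply: eq_recursive => v; rewrite (tnth_nth 0). Qed.

Lemma recursive1_const c : recursive1 (fun => c).
Proof.
elim: c => [|c IHc]; first exact: rec_zero.
by apply: (recursive_comp1 (f := S)) IHc; apply: rec_succ.
Qed.

Lemma recursive_const k c : recursive (fun _ : k.-tuple nat => c).
Proof.
have rec0: recursive (fun _ : k.-tuple nat => 0) by apply: rec_zero.
exact: recursive_comp1 (recursive1_const c) rec0.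
Qed.

Lemma recursive2_rec (g : nat -> nat) h f :
  recursive1 g -> recursive3 h -> (forall x, f 0 x = g x) ->
  (forall n x, f n.+1 x = h n (f n x) x) -> recursive2 f.
Proof.
move=> /recursive1P rec_g rec_h f0 fS.
by apply: (rec_prim rec_g rec_h) => [v|n v]; [apply: f0 | apply: fS].
Qed.

Lemma recursive2_iter g h :
  recursive1 g -> recursive1 h -> recursive2 (fun n x => iter n h (g x)).
Proof.
move=> rec_g rec_h; apply: (recursive2_rec (h := fun _ y _ => h y) rec_g) => //.
exact: recursive_comp1 (recursive_nth _ _).
Qed.

Lemma recursive1_rec c h f :
  recursive2 h -> f 0 = c -> (forall n, f n.+1 = h n (f n)) -> recursive1 f.
Proof.
move=> rec_h f0 fS; have rec_f: recursive2 (fun n _ => f n).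
  apply: (recursive2_rec (h := fun n y _ => h n y) (recursive1_const c)) => //.
  exact: recursive_comp2 (recursive_nth _ _) (recursive_nth _ _).
apply/recursive1P/(recursive_comp2 rec_f (recursive_nth _ 0)).
exact: recursive_nth 0.
Qed.

Lemma recursive1_mu p f : recursive2 p ->
  (forall x, p (f x) x = 0) -> (forall x n, n < f x -> p n x <> 0) ->
  recursive1 f.
Proof.
move=> rec_p pf f_min; apply/recursive1P; apply: (rec_mu rec_p) => v.
by split=> [|m]; [apply: pf | apply: f_min].
Qed.

Lemma recursive1_comp f g :
  recursive1 f -> recursive1 g -> recursive1 (fun x => f (g x)).
Proof. exact: recursive_comp1. Qed.

Lemma recursive1_comp2 f g h : recursive2 f -> recursive1 g -> recursive1 h ->
  recursive1 (fun x => f (g x) (h x)).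
Proof. exact: recursive_comp2. Qed.

Lemma recursive1_id : recursive1 id.
Proof. exact: (@rec_proj 1 ord0). Qed.

Lemma recursive1_succ : recursive1 succn.
Proof. exact: rec_succ. Qed.

Lemma recursive1_pred : recursive1 predn.
Proof.
exact: (recursive1_rec (h := fun n _ => n) (c := 0)) (recursive_nth _ _) _ _.
Qed.

Lemma recursive2_add : recursive2 addn.
Proof.
apply: eq_recursive (recursive2_iter recursive1_id recursive1_succ) => v.
by rewrite iter_succn addnC.
Qed.

Lemma recursive2_sub : recursive2 subn.
Proof.
have rec_iter := recursive2_iter recursive1_id recursive1_pred.
apply: eq_recursive (recursive_comp2 rec_iter
  (recursive_nth 2 1) (recursive_nth 2 0)) => v /=.
by elim: (nth 0 v 1) => /= [|m ->]; rewrite ?subn0 ?subnS.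
Qed.

Lemma recursive1_double : recursive1 double.
Proof.
apply: eq_recursive
  (recursive_comp2 recursive2_add recursive1_id recursive1_id).
by move=> v; rewrite addnn.
Qed.

Lemma recursive1_odd : recursive1 odd.
Proof.
apply: (recursive1_rec (h := fun _ b => 1 - b) (c := 0)) => // [|n].
  exact: recursive_comp2 recursive2_sub (recursive_const _ 1)
    (recursive_nth _ _).
by rewrite /=; case: (odd n).
Qed.

Lemma recursive1_half : recursive1 half.
Proof.
apply: (recursive1_rec (h := fun n b => odd n + b) (c := 0)) => // [|n].
  apply: recursive_comp2 recursive2_add _ (recursive_nth _ _).
  exact: recursive_comp1 recursive1_odd (recursive_nth _ _).
by rewrite -uphalf_half.
Qed.

Lemma recursive1_if c g h : recursive1 c -> recursive1 g -> recursive1 h ->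
  recursive1 (fun x => if c x == 0 then g x else h x).
Proof.
move=> rec_c rec_g rec_h.
have rec_if: recursive2 (fun n x => if n == 0 then g x else h x).
  apply: (recursive2_rec (h := fun _ _ x => h x) rec_g) => //.
  exact: recursive_comp1 (recursive_nth _ _).
exact: recursive1_comp2 rec_if rec_c recursive1_id.
Qed.

(** * Recursive list operations on codes *)

Definition code_head n := head 0 (CodeSeq.decode n).
Definition code_tail n := CodeSeq.code (behead (CodeSeq.decode n)).
Definition code_cons n m := 2 ^ n * m.*2.+1.
Definition code_pair m n := CodeSeq.code [:: m; n].

Lemma code_head_cons n s : code_head (CodeSeq.code (n :: s)) = n.
Proof. by rewrite /code_head CodeSeq.codeK. Qed.

Lemma code_tail_cons n s :
  code_tail (CodeSeq.code (n :: s)) = CodeSeq.code s.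
Proof. by rewrite /code_tail CodeSeq.codeK. Qed.

Lemma iter_half_pow2 h n q :
  h <= n -> iter h half (2 ^ n * q) = 2 ^ (n - h) * q.
Proof.
elim: h => [|h IHh] lt_hn /=; first by rewrite subn0.
by rewrite IHh ?(ltnW lt_hn) // -(subnSK lt_hn) expnS -mulnA mul2n doubleK.
Qed.

(** The code of n :: s is 2 ^ n times an odd number, so n is the number of
    halvings that lead to the first odd number. *)
Lemma recursive1_code_head : recursive1 code_head.
Proof.
have rec_half := recursive2_iter recursive1_id recursive1_half.
(* The summand 1 - m stops the search at once when m = 0, the empty list. *)
pose p h m := 1 - odd (iter h half m + (1 - m)).
apply: (recursive1_mu (p := p)) => [|m|m h].
- apply: recursive_comp2 recursive2_sub (recursive_const _ 1) _.
  apply: recursive_comp1 recursive1_odd _.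
  apply: recursive_comp2 recursive2_add _ _; first exact: rec_half.
  exact: recursive_comp2 recursive2_sub (recursive_const _ 1)
    (recursive_nth _ _).
- rewrite /p -[m]CodeSeq.decodeK; case: (CodeSeq.decode m) => // n s.
  have /eqnP code0: 0 < CodeSeq.code (n :: s) by rewrite muln_gt0 expn_gt0.
  rewrite code_head_cons code0 /= iter_half_pow2 // subnn mul1n addn0.
  by rewrite /= odd_double.
rewrite /p -[m]CodeSeq.decodeK; case: (CodeSeq.decode m) => // n s.
have /eqnP code0: 0 < CodeSeq.code (n :: s) by rewrite muln_gt0 expn_gt0.
rewrite code_head_cons code0 addn0 /= => lt_hn.
rewrite iter_half_pow2 1?ltnW //.
by rewrite oddM oddX -(subnSK lt_hn).
Qed.

Lemma recursive1_code_tail : recursive1 code_tail.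
Proof.
have rec_half := recursive2_iter recursive1_id recursive1_half.
have := recursive1_comp recursive1_half
  (recursive1_comp2 rec_half recursive1_code_head recursive1_id).
apply: eq_recursive => v; move: (tnth v ord0) => {v}m /=.
rewrite -[m]CodeSeq.decodeK; case: (CodeSeq.decode m) => // n s.
rewrite code_head_cons code_tail_cons /= iter_half_pow2 // subnn mul1n.
by rewrite /= uphalf_double.
Qed.

Lemma recursive2_code_cons : recursive2 code_cons.
Proof.
have rec_g: recursive1 (fun m => m.*2.+1).
  exact: recursive1_comp recursive1_succ recursive1_double.
apply: eq_recursive (recursive2_iter rec_g recursive1_double) => v.
rewrite /code_cons; elim: (nth 0 v 0) => [|n IHn] /=; first by rewrite mul1n.
by rewrite IHn expnS -mulnA mul2n.
Qed.

Lemma recursive2_code_pair : recursive2 code_pair.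
Proof.
apply: (recursive_comp2 recursive2_code_cons (recursive_nth _ _)).
exact: recursive_comp2 recursive2_code_cons (recursive_nth _ _)
  (recursive_const _ 0).
Qed.

(** * Computable functions between countable types *)

(** An inductive type and not an existential statement, so that unification
    never unfolds it while the closure lemmas are applied. *)
Variant computable (A B : countType) (f : A -> B) : Prop :=
  Computable g of recursive1 g & forall a, g (pickle a) = pickle (f a).

Lemma eq_computable (A B : countType) (f g : A -> B) :
  f =1 g -> computable f -> computable g.
Proof. by move=> eq_fg [h rec_h hf]; exists h => // a; rewrite -eq_fg. Qed.

(** Only codes matter, so values may change type without computation. *)
Lemma computable_recode (A B C : countType) (f : A -> B) (g : A -> C) :
  (forall a, pickle (f a) = pickle (g a)) -> computable f -> computable g.
Proof. by move=> eq_fg [h rec_h hf]; exists h => // a; rewrite -eq_fg. Qed.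

Lemma computable_id (A : countType) : computable (fun a : A => a).
Proof. by exists id; first exact: recursive1_id. Qed.

Lemma computable_const (A B : countType) (b : B) : computable (fun _ : A => b).
Proof. by exists (fun=> pickle b); first exact: recursive1_const. Qed.

Lemma computable_comp (A B C : countType) (f : B -> C) (g : A -> B) :
  computable f -> computable g -> computable (fun a => f (g a)).
Proof.
move=> [f' rec_f fE] [g' rec_g gE]; exists (fun x => f' (g' x)).
  exact: recursive1_comp.
by move=> a; rewrite gE fE.
Qed.

Lemma computable_pair (A B C : countType) (f : A -> B) (g : A -> C) :
  computable f -> computable g -> computable (fun a => (f a, g a)).
Proof.
move=> [f' rec_f fE] [g' rec_g gE]; exists (fun x => code_pair (f' x) (g' x)).
  exact: recursive1_comp2 recursive2_code_pair _ _.
by move=> a; rewrite gE fE.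
Qed.

Lemma computable_fst (A B C : countType) (f : A -> B * C) :
  computable f -> computable (fun a => (f a).1).
Proof.
move=> [f' rec_f fE]; exists (fun x => code_head (f' x)).
  exact: recursive1_comp recursive1_code_head _.
by move=> a; rewrite fE; case: (f a) => b c; rewrite code_head_cons.
Qed.

Lemma computable_snd (A B C : countType) (f : A -> B * C) :
  computable f -> computable (fun a => (f a).2).
Proof.
move=> [f' rec_f fE]; exists (fun x => code_head (code_tail (f' x))).
  apply: recursive1_comp recursive1_code_head _.
  exact: recursive1_comp recursive1_code_tail _.
move=> a; rewrite fE; case: (f a) => b c.
by rewrite code_tail_cons code_head_cons.
Qed.

Lemma computable_comp2 (A B C D : countType) (f : B -> C -> D)
    (g : A -> B) (h : A -> C) :
  computable (fun p : B * C => f p.1 p.2) -> computable g -> computable h ->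
  computable (fun a => f (g a) (h a)).
Proof.
move=> comp_f comp_g comp_h.
exact: (computable_comp comp_f (computable_pair comp_g comp_h)).
Qed.

Lemma computable_if (A B : countType) (c : A -> bool) (g h : A -> B) :
  computable c -> computable g -> computable h ->
  computable (fun a => if c a then g a else h a).
Proof.
move=> [c' rec_c cE] [g' rec_g gE] [h' rec_h hE].
exists (fun x => if c' x == 0 then h' x else g' x).
  exact: recursive1_if.
by move=> a; rewrite cE gE hE; case: (c a).
Qed.

Lemma computable_andb (A : countType) (f g : A -> bool) :
  computable f -> computable g -> computable (fun a => f a && g a).
Proof.
by move=> comp_f comp_g; apply: computable_if => //; apply: computable_const.
Qed.

Lemma computable_orb (A : countType) (f g : A -> bool) :
  computable f -> computable g -> computable (fun a => f a || g a).
Proof.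
by move=> comp_f comp_g; apply: computable_if => //; apply: computable_const.
Qed.

Lemma computable_negb (A : countType) (f : A -> bool) :
  computable f -> computable (fun a => ~~ f a).
Proof.
by move=> comp_f; apply: computable_if => //; apply: computable_const.
Qed.

Lemma computable_succ (A : countType) (f : A -> nat) :
  computable f -> computable (fun a => (f a).+1).
Proof.
by apply: computable_comp; exists succn => //; apply: recursive1_succ.
Qed.

Lemma computable_pred (A : countType) (f : A -> nat) :
  computable f -> computable (fun a => (f a).-1).
Proof.
by apply: computable_comp; exists predn => //; apply: recursive1_pred.
Qed.

Lemma computable_leq (A : countType) (f g : A -> nat) :
  computable f -> computable g -> computable (fun a => f a <= g a).
Proof.
move=> [f' rec_f fE] [g' rec_g gE].
exists (fun x => if f' x - g' x == 0 then 1 else 0).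
  apply: recursive1_if; try exact: recursive1_const.
  exact: recursive1_comp2 recursive2_sub _ _.
by move=> a; rewrite fE gE -[_ == 0]/(f a <= g a); case: leqP.
Qed.

Lemma computable_pickle (A B : countType) (f : A -> B) :
  computable f -> computable (fun a => pickle (f a)).
Proof. exact: computable_recode. Qed.

(** Coding is injective, so equality in any type reduces to equality of
    numbers. *)
Lemma computable_eq (A B : countType) (f g : A -> B) :
  computable f -> computable g -> computable (fun a => f a == g a).
Proof.
move=> /computable_pickle comp_f /computable_pickle comp_g.
apply: (eq_computable (f := fun a =>
  (pickle (f a) <= pickle (g a)) && (pickle (g a) <= pickle (f a)))) => [a|].
  by rewrite -eqn_leq (inj_eq (pcan_inj pickleK)).
by apply: computable_andb; apply: computable_leq.
Qed.

(** Variables of the context that occur in the iterated function are supplied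
    by the first component of the pair on which it is assumed computable.  The
    other higher-order lemmas below follow the same pattern. *)
Lemma computable_iter (A B : countType) (m : A -> nat) (h : A -> B -> B)
    (g : A -> B) :
  computable (fun p : A * B => h p.1 p.2) -> computable m -> computable g ->
  computable (fun a => iter (m a) (h a) (g a)).
Proof.
move=> [h' rec_h hE] [m' rec_m mE] [g' rec_g gE].
pose F n x := iter n (fun y => h' (code_pair x y)) (g' x).
exists (fun x => F (m' x) x); last first.
  move=> a; rewrite mE /F gE -[pickle (m a)]/(m a).
  by elim: (m a) => //= n ->; apply: (hE (_, _)).
apply: recursive1_comp2 _ rec_m recursive1_id.
apply: (recursive2_rec (h := fun _ y x => h' (code_pair x y)) rec_g) => //.
apply: recursive_comp1 rec_h _.
exact: recursive_comp2 recursive2_code_pair (recursive_nth _ _)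
  (recursive_nth _ _).
Qed.

(** * Computable list operations *)

Lemma computable_cons (A B : countType) (f : A -> B) (g : A -> seq B) :
  computable f -> computable g -> computable (fun a => f a :: g a).
Proof.
move=> [f' rec_f fE] [g' rec_g gE]; exists (fun x => code_cons (f' x) (g' x)).
  exact: recursive1_comp2 recursive2_code_cons _ _.
by move=> a; rewrite gE fE.
Qed.

Lemma computable_seq_case (A B T : countType) (l : A -> seq T) (g : A -> B)
    (h : A -> T -> seq T -> B) :
  computable l -> computable g ->
  computable (fun p : A * T * seq T => h p.1.1 p.1.2 p.2) ->
  computable (fun a => if l a is x :: s then h a x s else g a).
Proof.
move=> [l' rec_l lE] [g' rec_g gE] [h' rec_h hE].
exists (fun x => if l' x == 0 then g' x else
  h' (code_pair (code_pair x (code_head (l' x))) (code_tail (l' x)))).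
  apply: recursive1_if => //; apply: recursive1_comp => //.
  apply: recursive1_comp2 recursive2_code_pair _ _.
    apply: recursive1_comp2 recursive2_code_pair recursive1_id _.
    exact: recursive1_comp recursive1_code_head rec_l.
  exact: recursive1_comp recursive1_code_tail rec_l.
move=> a; rewrite lE gE; case: (l a) => // x s.
rewrite code_head_cons code_tail_cons -(hE (a, x, s)).
by rewrite eqn0Ngt muln_gt0 expn_gt0.
Qed.

Lemma computable_head (A T : countType) (x0 : T) (l : A -> seq T) :
  computable l -> computable (fun a => head x0 (l a)).
Proof.
move=> comp_l.
apply: (@computable_seq_case _ _ _ l (fun=> x0) (fun _ x _ => x)) => //.
  exact: computable_const.
by apply/computable_snd/computable_fst/computable_id.
Qed.

Lemma computable_behead (A T : countType) (l : A -> seq T) :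
  computable l -> computable (fun a => behead (l a)).
Proof.
move=> comp_l.
apply: (@computable_seq_case _ _ _ l (fun=> [::]) (fun _ _ s => s)) => //.
  exact: computable_const.
exact/computable_snd/computable_id.
Qed.

(** Reduces the computability of an expression to that of its immediate
    subexpressions.  The last two cases are a conditional, whose shape cannot be
    written as a pattern, and a function that is not an abstraction. *)
Ltac compute_step := cbv beta; lazymatch goal with
  | H : computable ?f |- computable ?f => exact H
  | |- computable (fun x => x) => exact: computable_id
  | |- computable (fun _ => ?b) => exact: computable_const
  | |- computable (fun x => (@?f x, @?g x)) =>
      refine (computable_pair (f := f) (g := g) _ _)
  | |- computable (fun x => (@?f x).1) => refine (computable_fst (f := f) _)
  | |- computable (fun x => (@?f x).2) => refine (computable_snd (f := f) _)
  | |- computable (fun x => @?f x && @?g x) =>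
      refine (computable_andb (f := f) (g := g) _ _)
  | |- computable (fun x => @?f x || @?g x) =>
      refine (computable_orb (f := f) (g := g) _ _)
  | |- computable (fun x => ~~ @?f x) => refine (computable_negb (f := f) _)
  | |- computable (fun x => (@?f x).+1) => refine (computable_succ (f := f) _)
  | |- computable (fun x => (@?f x).-1) => refine (computable_pred (f := f) _)
  | |- computable (fun x => @?f x <= @?g x) =>
      refine (computable_leq (f := f) (g := g) _ _)
  | |- computable (fun x => @?f x == @?g x) =>
      refine (computable_eq (f := f) (g := g) _ _)
  | |- computable (fun x => @?f x :: @?g x) =>
      refine (computable_cons (f := f) (g := g) _ _)
  | |- computable (fun x => head ?x0 (@?f x)) =>
      refine (computable_head x0 (l := f) _)
  | |- computable (fun x => behead (@?f x)) =>
      refine (computable_behead (l := f) _)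
  | |- computable (fun x => iter (@?m x) (@?h x) (@?g x)) =>
      refine (computable_iter (m := m) (h := h) (g := g) _ _ _)
  | |- computable (fun _ => _) => refine (computable_if _ _ _)
  | |- computable ?f => change (computable (fun x => f x))
  end.

Ltac computes := repeat compute_step.

Lemma computable_foldl (A B T : countType) (h : A -> B -> T -> B) (g : A -> B)
    (l : A -> seq T) :
  computable (fun p : A * B * T => h p.1.1 p.1.2 p.2) ->
  computable g -> computable l -> computable (fun a => foldl (h a) (g a) (l a)).
Proof.
move=> comp_h comp_g comp_l.
pose step a (p : seq T * B) := if p.1 is x :: s then (s, h a p.2 x) else p.
(* The code of a list bounds its size, hence the number of steps needed. *)
apply: (eq_computable
  (f := fun a => (iter (pickle (l a)) (step a) (l a, g a)).2)) => [a|].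
  have: size (l a) <= pickle (l a).
    rewrite -(size_map pickle).
    rewrite -[pickle (l a)]/(CodeSeq.code (map pickle (l a))).
    elim: (map _ _) => //= x s IHs.
    apply: leq_ltn_trans IHs _.
    apply: leq_trans (leq_pmull _ _); last by rewrite expn_gt0.
    by rewrite ltnS -addnn leq_addr.
  move: (pickle _) => n; elim: n (l a) (g a) => [|n IHn] [|x s] b // le_sn.
    by rewrite iterSr IHn.
  by rewrite iterSr IHn.
have comp_step: computable (fun p : A * (seq T * B) => step p.1 p.2).
  apply: (@computable_seq_case _ _ _ (fun p => p.2.1) snd
    (fun p x s => (s, h p.1 p.2.2 x))); computes.
  apply: (@computable_comp _ _ _ _ (fun p : A * (seq T * B) * T * seq T =>
    (p.1.1.1, p.1.1.2.2, p.1.2)) comp_h).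
  by computes.
apply/computable_snd/computable_iter => //; first exact: computable_pickle.
exact: computable_pair.
Qed.

Lemma computable_nth (A T : countType) (x0 : T) (l : A -> seq T)
    (n : A -> nat) :
  computable l -> computable n -> computable (fun a => nth x0 (l a) (n a)).
Proof.
move=> comp_l comp_n.
apply: (eq_computable (f := fun a => head x0 (iter (n a) behead (l a)))).
  move=> a; elim: (n a) (l a) => [|m IHm] [|x s] //.
    by rewrite iterSr IHm !nth_nil.
  by rewrite iterSr IHm.
by computes.
Qed.

Lemma computable_foldr (A B T : countType) (h : A -> T -> B -> B) (g : A -> B)
    (l : A -> seq T) :
  computable (fun p : A * T * B => h p.1.1 p.1.2 p.2) ->
  computable g -> computable l -> computable (fun a => foldr (h a) (g a) (l a)).
Proof.
move=> comp_h comp_g comp_l.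
pose rv a := foldl (fun s (x : T) => x :: s) [::] (l a).
apply: (eq_computable (f := fun a => foldl (fun b x => h a x b) (g a) (rv a))).
  move=> a; rewrite -foldl_rev; congr foldl; rewrite /rv.
  by rewrite -[l a in LHS]revK foldl_rev; elim: (rev _) => //= x s ->.
have comp_rv: computable rv by apply: computable_foldl; computes.
apply: computable_foldl => //.
apply: (computable_comp (g := fun p : A * B * T => (p.1.1, p.2, p.1.2)) comp_h).
by computes.
Qed.

Lemma computable_map (A B T : countType) (f : A -> T -> B) (l : A -> seq T) :
  computable (fun p : A * T => f p.1 p.2) -> computable l ->
  computable (fun a => [seq f a x | x <- l a]).
Proof.
move=> comp_f comp_l.
apply: (computable_foldr (h := fun a x s => f a x :: s)) => //;
  last by computes.
apply: computable_cons; last by computes.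
apply: (computable_comp2 (f := f)) => //; by computes.
Qed.

Lemma computable_all (A T : countType) (f : A -> T -> bool) (l : A -> seq T) :
  computable (fun p : A * T => f p.1 p.2) -> computable l ->
  computable (fun a => all (f a) (l a)).
Proof.
move=> comp_f comp_l.
apply: (computable_foldr (h := fun a x b => f a x && b)) => //;
  last by computes.
apply: computable_andb; last by computes.
apply: (computable_comp2 (f := f)) => //; by computes.
Qed.

Lemma computable_mem (A T : countType) (f : A -> T) (l : A -> seq T) :
  computable f -> computable l -> computable (fun a => f a \in l a).
Proof.
move=> comp_f comp_l.
apply: (eq_computable (f := fun a => ~~ all (fun x => ~~ (x == f a)) (l a))).
  by move=> a; rewrite -has_predC -has_pred1; apply: eq_has => x /=;
    rewrite negbK.
apply/computable_negb/computable_all => //; apply/computable_negb.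
apply: computable_eq; first by computes.
apply: (computable_comp comp_f); by computes.
Qed.

Lemma computable_cat (A T : countType) (l s : A -> seq T) :
  computable l -> computable s -> computable (fun a => l a ++ s a).
Proof.
move=> comp_l comp_s; apply: (eq_computable
  (f := fun a => foldr cons (s a) (l a))) => [a|].
  by elim: (l a) => //= x r ->.
by apply: computable_foldr => //; computes.
Qed.

Lemma computable_size (A T : countType) (l : A -> seq T) :
  computable l -> computable (fun a => size (l a)).
Proof.
move=> comp_l; apply: (eq_computable
  (f := fun a => foldr (fun _ n => n.+1) 0 (l a))) => [a|].
  by elim: (l a) => //= x r ->.
by apply: computable_foldr => //; computes.
Qed.

Lemma pickle_seq_nat (s : seq nat) : pickle s = CodeSeq.code s.
Proof. by rewrite -[LHS]/(CodeSeq.code (map id s)) map_id. Qed.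

Lemma computable_code (A : countType) (l : A -> seq nat) :
  computable l -> computable (fun a => CodeSeq.code (l a)).
Proof.
by apply: computable_recode => a; rewrite pickle_seq_nat.
Qed.

Lemma computable_decode (A : countType) (n : A -> nat) :
  computable n -> computable (fun a => CodeSeq.decode (n a)).
Proof.
by apply: computable_recode => a; rewrite pickle_seq_nat CodeSeq.decodeK.
Qed.

Ltac compute_list_step := cbv beta; lazymatch goal with
  | |- computable (fun x => nth ?x0 (@?l x) (@?n x)) =>
      refine (computable_nth x0 (l := l) (n := n) _ _)
  | |- computable (fun x => foldl (@?h x) (@?g x) (@?l x)) =>
      refine (computable_foldl (h := h) (g := g) (l := l) _ _ _)
  | |- computable (fun x => foldr (@?h x) (@?g x) (@?l x)) =>
      refine (computable_foldr (h := h) (g := g) (l := l) _ _ _)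
  | |- computable (fun x => map (@?f x) (@?l x)) =>
      refine (computable_map (f := f) (l := l) _ _)
  | |- computable (fun x => all (@?f x) (@?l x)) =>
      refine (computable_all (f := f) (l := l) _ _)
  | |- computable (fun x => in_mem _ _) => refine (computable_mem _ _)
  | |- computable (fun x => @?l x ++ @?s x) =>
      refine (computable_cat (l := l) (s := s) _ _)
  | |- computable (fun x => size (@?l x)) =>
      refine (computable_size (l := l) _)
  | |- computable (fun x => CodeSeq.code (@?l x)) =>
      refine (computable_code (l := l) _)
  | |- computable (fun x => CodeSeq.decode (@?n x)) =>
      refine (computable_decode (n := n) _)
  end.

Ltac computes ::= repeat first [compute_list_step | compute_step].

(** The formulas and rules of a calculus are parameters of the computations
    below, never data: an operation over a fixed list of them is a finite
    composition, whatever their type. *)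
Lemma computable_map_fixed (A B : countType) I (s : seq I) (F : I -> A -> B) :
  (forall i, computable (F i)) -> computable (fun a => [seq F i a | i <- s]).
Proof.
move=> comp_F; elim: s => [|i s IHs] /=; first by computes.
by move: (comp_F i) => comp_Fi; computes.
Qed.

Lemma computable_all_fixed (A : countType) I (s : seq I) (c : I -> A -> bool) :
  (forall i, computable (c i)) -> computable (fun a => all (c^~ a) s).
Proof.
move=> comp_c; elim: s => [|i s IHs] /=; first by computes.
by move: (comp_c i) => comp_ci; computes.
Qed.

Lemma computable_filter_fixed (A B : countType) I (s : seq I)
    (c : I -> A -> bool) (F : I -> A -> B) :
  (forall i, computable (c i)) -> (forall i, computable (F i)) ->
  computable (fun a => [seq F i a | i <- s & c i a]).
Proof.
move=> comp_c comp_F; elim: s => [|i s IHs] /=; first by computes.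
move: (comp_c i) (comp_F i) => comp_ci comp_Fi.
apply: (eq_computable (f := fun a =>
  if c i a then F i a :: [seq F j a | j <- s & c j a]
  else [seq F j a | j <- s & c j a])) => [a|]; first by case: (c i a).
by computes.
Qed.

(** * Course-of-values recursion and unbounded search *)

Section CodeRecursion.

Variables (B : Type) (b0 : B) (g : seq nat -> seq B -> B).

(** Given the values at 0, ..., n-1, appends the value at n.  The function g
    receives the list coded by n and the values already found at its entries. *)
Definition extend_table (t : seq B) : seq B :=
  t ++ [:: g (CodeSeq.decode (size t))
             [seq nth b0 t i | i <- CodeSeq.decode (size t)]].

Definition code_rec (n : nat) : B :=
  nth b0 (iter n.+1 extend_table [::]) n.

Lemma size_iter_extend n : size (iter n extend_table [::]) = n.
Proof. by elim: n => //= n IHn; rewrite size_cat IHn addn1. Qed.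

Lemma nth_iter_extend n i :
  i < n -> nth b0 (iter n extend_table [::]) i = code_rec i.
Proof.
elim: n => // n IHn; rewrite ltnS leq_eqVlt => /predU1P[-> // | lt_in].
by rewrite iterS nth_cat size_iter_extend lt_in IHn.
Qed.

Lemma code_recE n : code_rec n =
  g (CodeSeq.decode n) [seq code_rec i | i <- CodeSeq.decode n].
Proof.
rewrite {1}/code_rec iterS nth_cat size_iter_extend ltnn subnn /=.
congr g.
apply/eq_in_map => i /(allP (CodeSeq.gtn_decode n)); exact: nth_iter_extend.
Qed.

End CodeRecursion.

Lemma computable_code_rec (A B : countType) (b0 : B)
    (g : A -> seq nat -> seq B -> B) (n : A -> nat) :
  computable (fun p : A * seq nat * seq B => g p.1.1 p.1.2 p.2) ->
  computable n -> computable (fun a => code_rec b0 (g a) (n a)).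
Proof.
move=> comp_g comp_n; rewrite /code_rec /extend_table; computes.
apply: (computable_comp (g := fun p : A * seq B =>
  (p.1, CodeSeq.decode (size p.2),
   [seq nth b0 p.2 i | i <- CodeSeq.decode (size p.2)])) comp_g).
by computes.
Qed.

(** Searching through a type amounts to searching through numbers when every
    number is a code. *)
Lemma pickle_seq_onto (T : countType) :
  (forall n, exists x : T, pickle x = n) ->
  forall n, exists s : seq T, pickle s = n.
Proof.
move=> onto n; rewrite -[n]CodeSeq.decodeK.
elim: (CodeSeq.decode n) => [|m l [s def_s]]; first by exists [::].
have [x def_x] := onto m; exists (x :: s).
by rewrite -[LHS]/(CodeSeq.code (pickle x :: map pickle s)) def_x /= -def_s.
Qed.

Lemma computable_search (W : countType) (p : nat -> W -> bool) :
  (forall n, exists w : W, pickle w = n) ->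
  computable (fun q : nat * W => p q.1 q.2) ->
  (forall x, exists w, p x w) ->
  exists2 f : nat -> W, computable f & forall x, p x (f x).
Proof.
move=> onto [q rec_q qE] p_ex.
have {}onto n: exists w : W, pickle w == n.
  by have [w <-] := onto n; exists w.
pose unp n := xchoose (onto n).
have unpK n : pickle (unp n) = n by apply/eqP/(xchooseP (onto n)).
have qP x n : q (code_pair x n) = p x (unp n).
  by rewrite -{1}[n]unpK (qE (x, _)).
have ex_n x : exists n, p x (unp n).
  have [w pxw] := p_ex x; exists (pickle w).
  by rewrite (pcan_inj pickleK (unpK (pickle w))).
pose f x := ex_minn (ex_n x).
have pf x : p x (unp (f x)) by rewrite /f; case: ex_minnP.
exists (fun x => unp (f x)) => //; exists f => // {qE}.
apply: (recursive1_mu (p := fun n x => 1 - q (code_pair x n))) => [|x|x n].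
- apply: recursive_comp2 recursive2_sub (recursive_const _ 1) _.
  apply: recursive_comp1 rec_q _.
  exact: recursive_comp2 recursive2_code_pair (recursive_nth _ _)
    (recursive_nth _ _).
- by rewrite qP pf.
rewrite qP /f; case: ex_minnP => m _ m_min.
by case pxn: (p x _) => //; rewrite ltnNge m_min.
Qed.

(** * Formula codes *)

Section FormulaCodes.

Variable L : language.

Local Notation code := (@formula_code L).

Definition arities := [seq arity c | c <- enum (connective L)].

(** Variables are treated as one more connective, of rank 0 and arity 1, whose
    argument may be any number. *)
Definition is_code_step (l : seq nat) (bs : seq bool) : bool :=
  [&& head 0 l <= #|connective L|,
      size (behead l) == nth 0 (1 :: arities) (head 0 l) &
      (head 0 l == 0) || all id (behead bs)].

Definition is_code (n : nat) : bool := code_rec false is_code_step n.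

Lemma is_code_formula F : is_code (code F).
Proof.
elim/formula_ffun_ind: F => [n|c a IHa].
  by rewrite /is_code code_recE CodeSeq.codeK.
rewrite /is_code code_recE CodeSeq.codeK /is_code_step /= ltn_ord.
rewrite size_map size_enum_ord (nth_map c) -?cardE //.
rewrite nth_enum_rank eqxx -map_comp all_map.
by apply/allP => i _; apply: IHa.
Qed.

Lemma is_codeP n : reflect (exists F, n = code F) (is_code n).
Proof.
apply: (iffP idP) => [|[F ->]]; last exact: is_code_formula.
elim/ltn_ind: n => n IHn; rewrite /is_code code_recE.
move: (CodeSeq.decodeK n) (CodeSeq.gtn_decode n).
case: (CodeSeq.decode n) => [|[|k] t] def_n; rewrite /is_code_step /=.
- by [].
- move=> _; rewrite andbT => /eqP size_t; move: def_n.
  by case: t size_t => [|m []] // _ <-; exists (Var m).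
case/andP=> _ lt_tn; case/and3P=> lt_k /eqP.
pose c := enum_val (Ordinal lt_k); have rank_c: enum_rank c = k :> nat.
  by rewrite enum_valK.
rewrite (nth_map c) -?cardE // -{1}rank_c nth_enum_rank => size_t.
rewrite all_map => /allP t_code.
have /fin_all_exists[a def_a] (i : 'I_(arity c)):
    exists F, nth 0 t i = code F.
  have t_i: nth 0 t i \in t by rewrite mem_nth ?size_t.
  by apply: IHn; [apply: (allP lt_tn) | apply: t_code].
exists (App c [ffun i => a i]); rewrite -def_n /= rank_c.
congr (CodeSeq.code (_ :: _)).
apply: (@eq_from_nth _ 0) => [|i]; first by rewrite size_map size_enum_ord.
rewrite size_t => lt_i; rewrite (nth_map (Ordinal lt_i)) ?size_enum_ord //.
by rewrite ffunE -def_a nth_enum_ord.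
Qed.

Lemma computable_is_code : computable is_code.
Proof.
apply: (@computable_code_rec _ _ false (fun=> is_code_step) id).
  by rewrite /is_code_step; computes.
exact: computable_id.
Qed.

(** * Enumerating the theorems *)

(** The default entry of a list that stands for a substitution: it has to be the
    code of a formula, so that every instance is one too. *)
Definition code0 := code (Var 0).

Fixpoint subst_code (l : seq nat) (F : formula L) : nat :=
  match F with
  | Var n => nth code0 l n
  | App c a => CodeSeq.code
      ((enum_rank c).+1 :: [seq subst_code l (a i) | i <- enum 'I_(arity c)])
  end.

Lemma ltn_code_Var n : n < code (Var n).
Proof. by have /and3P[] := CodeSeq.ltn_code [:: 0; n]. Qed.

Lemma ltn_code_App c (a : {ffun 'I_(arity c) -> formula L}) i :
  code (a i) < code (App c a).
Proof.
have /= /andP[_ /allP] := CodeSeq.ltn_code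
  ((enum_rank c).+1 :: [seq code (a i) | i <- enum 'I_(arity c)]).
by apply; apply: map_f; rewrite mem_enum.
Qed.

(** The variables of a formula, being smaller than its code, are all read from
    the list if the list has that length. *)
Lemma subst_codeE l sigma F :
  (forall n, n < code F -> nth code0 l n = code (sigma n)) ->
  subst_code l F = code (subst sigma F).
Proof.
elim/formula_ffun_ind: F => [n|c a IHa] l_sigma.
  exact/l_sigma/ltn_code_Var.
congr (CodeSeq.code (_ :: _)); apply/eq_in_map => i _; rewrite ffunE.
by apply: IHa => n /ltn_trans lt_n; apply/l_sigma/lt_n/ltn_code_App.
Qed.

Lemma computable_subst_code F : computable (subst_code^~ F).
Proof.
elim/formula_ffun_ind: F => [n|c a IHa].
  exact: (computable_nth code0 (computable_id _) (computable_const _ n)).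
apply: computable_code; apply: computable_cons; first exact: computable_const.
exact: computable_map_fixed.
Qed.

Variable C : calculus L.

(** An axiom is a rule without premises. *)
Definition schemes : seq (seq (formula L) * formula L) :=
  [seq ([::], A) | A <- axioms C] ++ rules C.

Lemma justifiedE prev F : justified C prev F <-> exists r sigma,
  [/\ r \in schemes, forall A, A \in r.1 -> subst sigma A \in prev &
      F = subst sigma r.2].
Proof.
split=> [[[A [sigma [ax_A ->]]] | [r [sigma [rule_r prem ->]]]] |].
- by exists ([::], A), sigma; split; rewrite // mem_cat map_f.
- by exists r, sigma; split; rewrite // mem_cat rule_r orbT.
case=> r [sigma [+ prem ->]]; rewrite mem_cat => /orP[/mapP[A ax_A ->]|rule_r].
  by left; exists A, sigma.
by right; exists r, sigma.
Qed.

Lemma justified_sub s t F :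
  {subset s <= t} -> justified C s F -> justified C t F.
Proof.
move=> sub_st /justifiedE[r [sigma [? prem ->]]]; apply/justifiedE.
by exists r, sigma; split=> // A /prem/sub_st.
Qed.

Lemma derivation_rcons s F :
  derivation C (rcons s F) <-> derivation C s /\ justified C s F.
Proof.
split=> [der_sF|[der_s just_F] prev G next].
  split=> [prev G next def_s|]; last by apply: (der_sF s F [::]); rewrite cats1.
  by apply: (der_sF _ _ (rcons next F)); rewrite def_s rcons_cat.
case: (lastP next) => [|next' H].
  by rewrite cats1 => /rcons_inj[<- <-].
by rewrite -rcons_cons -rcons_cat => /rcons_inj[/der_s].
Qed.

Lemma derivation_cat s t : derivation C s ->
  (forall F, F \in t -> justified C s F) -> derivation C (s ++ t).
Proof.
move=> der_s; elim/last_ind: t => [|t F IHt] just_t; first by rewrite cats0.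
rewrite -rcons_cat; apply/derivation_rcons; split.
  by apply: IHt => G t_G; apply: just_t; rewrite mem_rcons inE t_G orbT.
apply: (justified_sub (s := s)) => [G s_G|]; first by rewrite mem_cat s_G.
by apply: just_t; rewrite mem_rcons inE eqxx.
Qed.

(** One round of the enumeration, for the substitution coded by l.  The guard
    confines T to codes of formulas: a list l with a meaningless entry adds
    nothing. *)
Definition consequences (T l : seq nat) : seq nat :=
  if all is_code l then
    T ++ [seq subst_code l r.2 |
           r <- schemes & all (fun A => subst_code l A \in T) r.1]
  else T.

Definition theorem_codes (w : seq (seq nat)) : seq nat :=
  foldl consequences [::] w.

Lemma all_is_codeP l : all is_code l -> exists s, l = map code s.
Proof.
elim: l => [|n l IHl] /=; first by exists [::].
by case/andP=> /is_codeP[F ->] /IHl[s ->]; exists (F :: s).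
Qed.

(** The list produced by a round is itself the list of codes of a derivation. *)
Lemma theorem_codes_sound w F : code F \in theorem_codes w -> Thm C F.
Proof.
have [s -> der_s]: exists2 s, theorem_codes w = map code s & derivation C s.
  elim/last_ind: w => [|w l [s def_T der_s]].
    by exists [::] => // - [].
  rewrite /theorem_codes foldl_rcons -/(theorem_codes w) def_T /consequences.
  case: ifP => [/all_is_codeP[u def_l]|_]; last by exists s.
  pose sigma := nth (Var 0) u.
  have substE A : subst_code l A = code (subst sigma A).
    apply: subst_codeE => n _; rewrite /sigma def_l.
    have [lt_n|le_n] := ltnP n (size u); first by rewrite (nth_map (Var 0)).
    by rewrite !nth_default ?size_map.
  exists (s ++ [seq subst sigma r.2 |
    r <- schemes & all (fun A => subst sigma A \in s) r.1]).
    rewrite map_cat -map_comp; congr (_ ++ _).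
    rewrite (eq_map (g := code \o (fun r => subst sigma r.2))) => [|r] //=.
    congr map; apply: eq_filter => r; apply: eq_all => A.
    by rewrite substE (mem_map (@formula_code_inj L)).
  apply: derivation_cat => // G /mapP[r].
  rewrite mem_filter => /andP[/allP prem r_in ->].
  by apply/justifiedE; exists r, sigma.
rewrite (mem_map (@formula_code_inj L)) => /path.splitPr s_F.
case: s_F der_s => s1 s2 der_s; exists s1 => prev G next def_s1.
apply: (der_s _ _ (next ++ s2)).
by rewrite -cat_rcons def_s1 -catA.
Qed.

Lemma sub_consequences T l : {subset T <= consequences T l}.
Proof.
by move=> n T_n; rewrite /consequences; case: ifP; rewrite // mem_cat T_n.
Qed.

(** The witness lists the substitutions that justify the successive lines of a
    derivation, each cut off at a bound for the variables of its rule. *)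
Lemma theorem_codes_complete F :
  Thm C F -> exists w, code F \in theorem_codes w.
Proof.
case=> s der_sF; suffices [w T_w]: exists w, forall G,
    G \in rcons s F -> code G \in theorem_codes w.
  by exists w; apply: T_w; rewrite mem_rcons inE eqxx.
elim/last_ind: (rcons s F) der_sF => {s F} [|s F IHs]; first by exists [::].
case/derivation_rcons => /IHs[w T_w] /justifiedE[r [sigma [r_in prem def_F]]].
(* Codes bound variables, so K bounds the variables of the rule. *)
pose K := \max_(A <- r.2 :: r.1) code A.
pose l := mkseq (code \o sigma) K.
have substE A : A \in r.2 :: r.1 -> subst_code l A = code (subst sigma A).
  move=> A_in; apply: subst_codeE => n lt_n; rewrite nth_mkseq //.
  by apply: leq_trans lt_n _; apply: leq_bigmax_seq.
exists (rcons w l) => G.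
rewrite mem_rcons inE => /predU1P[-> | s_G]; last first.
  by rewrite /theorem_codes foldl_rcons; apply/sub_consequences/T_w.
rewrite /theorem_codes foldl_rcons -/(theorem_codes w) /consequences.
have ->: all is_code l.
  by apply/allP => _ /mapP[n _ ->]; apply: is_code_formula.
rewrite mem_cat def_F -substE ?mem_head // orbC; apply/orP; left.
apply/mapP; exists r => //; rewrite mem_filter r_in andbT.
apply/allP => A r_A; rewrite substE ?inE ?r_A ?orbT //.
exact/T_w/prem.
Qed.

Lemma computable_theorem_codes : computable theorem_codes.
Proof.
apply: computable_foldl; [|by computes|by computes].
rewrite /consequences; computes.
  by apply: (computable_comp computable_is_code); computes.
have comp_subst A : computable (fun p : seq (seq nat) * seq nat * seq nat =>
    subst_code p.2 A).
  by apply: (computable_comp (computable_subst_code A)); computes.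
apply: computable_filter_fixed => r; last exact: comp_subst.
apply: computable_all_fixed => A; have comp_A := comp_subst A.
by apply: computable_mem; computes.
Qed.

End FormulaCodes.

(** * Evaluation in a finite-valued logic *)

(** A row of a truth table is the value followed by the arguments. *)
Definition lookup (rows : seq (seq nat)) (args : seq nat) : nat :=
  foldr (fun row y => if behead row == args then head 0 row else y) 0 rows.

(** Makes any number the rank of a truth value, so that any list of numbers
    stands for a valuation. *)
Definition clip (N k : nat) : nat := if k < N then k else 0.

Definition eval_step (N : nat) (tables : seq (seq (seq nat))) (v l vs : seq nat)
    : nat :=
  if head 0 l == 0 then clip N (nth 0 v (nth 0 l 1))
  else lookup (nth [::] tables (head 0 l).-1) (behead vs).

Definition eval_code (N : nat) (tables : seq (seq (seq nat))) (v : seq nat)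
    (n : nat) : nat :=
  code_rec 0 (eval_step N tables v) n.

Lemma computable_lookup (A : countType) (rows : A -> seq (seq nat))
    (args : A -> seq nat) :
  computable rows -> computable args ->
  computable (fun a => lookup (rows a) (args a)).
Proof.
move=> comp_rows comp_args; rewrite /lookup; computes.
by apply: (computable_comp comp_args); computes.
Qed.

Lemma computable_eval_code (A : countType) (N : A -> nat)
    (tables : A -> seq (seq (seq nat))) (v : A -> seq nat) (n : A -> nat) :
  computable N -> computable tables -> computable v -> computable n ->
  computable (fun a => eval_code (N a) (tables a) (v a) (n a)).
Proof.
move=> comp_N comp_t comp_v comp_n.
apply: (@computable_code_rec _ _ 0
  (fun a => eval_step (N a) (tables a) (v a)) n)
  => //.
rewrite /eval_step /clip.
have comp_a: computable (fun p : A * seq nat * seq nat => p.1.1) by computes.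
have {}comp_N := computable_comp comp_N comp_a.
have {}comp_t := computable_comp comp_t comp_a.
have {}comp_v := computable_comp comp_v comp_a.
computes; apply: computable_lookup; computes.
Qed.

Lemma lookup_map (T : eqType) (val : T -> nat) (args : T -> seq nat)
    (s : seq T) x :
  injective args -> x \in s ->
  lookup [seq val y :: args y | y <- s] (args x) = val x.
Proof.
move=> args_inj; elim: s => //= y s IHs; rewrite inE (inj_eq args_inj) eq_sym.
by case: eqVneq => [-> | _ /IHs].
Qed.

Section LogicTables.

Variables (L : language) (M : logic L).

Definition args_code (c : connective L) (x : {ffun 'I_(arity c) -> value M}) :
    seq nat :=
  [seq (enum_rank (x i) : nat) | i <- enum 'I_(arity c)].

Definition truth_table (c : connective L) : seq (seq nat) :=
  [seq (enum_rank (truth x) : nat) :: args_code x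
     | x <- enum {: {ffun 'I_(arity c) -> value M}}].

Definition truth_tables : seq (seq (seq nat)) :=
  [seq truth_table c | c <- enum (connective L)].

Definition designated_ranks : seq nat :=
  [seq (enum_rank x : nat) | x <- enum (designated M)].

(** The parts of the code of a logic are the codes of the typed tables used for
    evaluation, whence these are computable from it. *)
Lemma logic_codeE : logic_code M =
  CodeSeq.code [:: #|value M|; pickle designated_ranks; pickle truth_tables].
Proof.
congr (CodeSeq.code [:: _; _; _]); rewrite ?pickle_seq_nat //.
congr CodeSeq.code; rewrite -[RHS]map_comp; apply: eq_map => c.
congr CodeSeq.code; rewrite -[RHS]map_comp; apply: eq_map => x.
by rewrite /= pickle_seq_nat.
Qed.

Lemma args_code_inj c : injective (@args_code c).
Proof.
move=> x y /eq_in_map eq_xy; apply/ffunP => i.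
by apply/enum_rank_inj/ord_inj/eq_xy; rewrite mem_enum.
Qed.

Lemma lookup_truth (c : connective L) (x : {ffun 'I_(arity c) -> value M}) :
  lookup (nth [::] truth_tables (enum_rank c)) (args_code x) =
  enum_rank (truth x).
Proof.
rewrite (nth_map c) -?cardE // nth_enum_rank.
apply: (lookup_map (fun x => enum_rank (truth x))); last by rewrite mem_enum.
exact: args_code_inj.
Qed.

Lemma eval_codeE (val : nat -> value M) (v : seq nat) (F : formula L) :
  (forall n, n < formula_code F ->
     clip #|value M| (nth 0 v n) = enum_rank (val n)) ->
  eval_code #|value M| truth_tables v (formula_code F) = enum_rank (eval val F).
Proof.
elim/formula_ffun_ind: F => [n|c a IHa] val_v; rewrite /eval_code code_recE.
  by rewrite CodeSeq.codeK /eval_step /=; apply/val_v/ltn_code_Var.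
rewrite CodeSeq.codeK /eval_step [_ == 0]/= [_.-1]/= [behead _]/= -lookup_truth.
congr lookup; rewrite -map_comp; apply/eq_in_map => i _; rewrite ffunE /=.
by apply: IHa => n /ltn_trans lt_n; apply/val_v/lt_n/ltn_code_App.
Qed.

Definition refutes (v : seq nat) (n : nat) : bool :=
  eval_code #|value M| truth_tables v n \notin designated_ranks.

Lemma refutesE (val : nat -> value M) v F :
  (forall n, n < formula_code F ->
     clip #|value M| (nth 0 v n) = enum_rank (val n)) ->
  refutes v (formula_code F) = ~~ satisfies val F.
Proof.
move=> val_v; rewrite /refutes (eval_codeE val_v) /designated_ranks.
rewrite (mem_map (inj_comp (@ord_inj _) (@enum_rank_inj _))).
by rewrite mem_enum.
Qed.

Lemma clip_enum_rank k : exists x : value M, clip #|value M| k = enum_rank x.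
Proof.
have lt_k: clip #|value M| k < #|value M|.
  by rewrite /clip; case: ifP => // _; apply: value_nonempty.
by exists (enum_val (Ordinal lt_k)); rewrite enum_valK.
Qed.

Lemma refutes_not_Taut v F : refutes v (formula_code F) -> ~ Taut M F.
Proof.
pose rank_eq k (x : value M) := clip #|value M| k == enum_rank x :> nat.
have ex_x k : exists x : value M, rank_eq k x.
  by have [x def_k] := clip_enum_rank k; exists x; apply/eqP.
pose val n := xchoose (ex_x (nth 0 v n)).
rewrite (refutesE (val := val)) => [not_sat /(_ val) | n _]; first exact/negP.
exact/eqP/(xchooseP (ex_x (nth 0 v n))).
Qed.

Lemma not_Taut_refutes F : ~ Taut M F -> exists v, refutes v (formula_code F).
Proof.
case/not_all_ex_not => val /negP not_sat.
exists (mkseq (fun n => enum_rank (val n) : nat) (formula_code F)).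
rewrite (refutesE (val := val)) // => n lt_n.
by rewrite nth_mkseq // /clip ltn_ord.
Qed.

End LogicTables.

(** * Approximable calculi are decidable *)

Section Decision.

Variables (L : language) (C : calculus L) (M : nat -> logic L).
Hypothesis M_rec : recursive_sequence M.
Hypothesis M_Thm : forall F, Thm C F <-> forall j, Taut (M j) F.

Lemma computable_refutes (A : countType) (j : A -> nat) (v : A -> seq nat)
    (n : A -> nat) :
  computable j -> computable v -> computable n ->
  computable (fun a => refutes (M (j a)) (v a) (n a)).
Proof.
move=> comp_j comp_v comp_n.
have comp_M: computable (fun a => logic_code (M (j a))).
  apply: (computable_comp (f := fun i => logic_code (M i)) _ comp_j).
  by exists (fun i => logic_code (M i)).
have comp_part k :
    computable (fun a => nth 0 (CodeSeq.decode (logic_code (M (j a)))) k).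
  by computes.
have partE k i : nth 0 (CodeSeq.decode (logic_code (M i))) k = nth 0
    [:: #|value (M i)|; pickle (designated_ranks (M i));
        pickle (truth_tables (M i))] k.
  by rewrite logic_codeE CodeSeq.codeK.
have comp_N: computable (fun a => #|value (M (j a))|).
  by apply: computable_recode (comp_part 0) => a; rewrite partE.
have comp_D: computable (fun a => designated_ranks (M (j a))).
  by apply: computable_recode (comp_part 1) => a; rewrite partE.
have comp_T: computable (fun a => truth_tables (M (j a))).
  by apply: computable_recode (comp_part 2) => a; rewrite partE.
by apply/computable_negb/computable_mem => //; apply: computable_eval_code.
Qed.

(** A single search covers three outcomes: n is not the code of a formula, w
    derives n, or the first entry j :: v of w refutes n in M_j by the valuation
    v.  The first one makes the search succeed on every number, as a total
    recursive function requires. *)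
Definition settles (n : nat) (w : seq (seq nat)) : bool :=
  [|| ~~ is_code L n, n \in theorem_codes C w |
      refutes (M (head 0 (head [::] w))) (behead (head [::] w)) n].

Lemma settles_ex n : exists w, settles n w.
Proof.
rewrite /settles; case: is_codeP => [[F ->]|_]; last by exists [::].
have [/theorem_codes_complete[w w_F]|not_F] := classic (Thm C F).
  by exists w; rewrite w_F.
have [j /not_Taut_refutes[v v_F]]: exists j, ~ Taut (M j) F.
  by apply: not_all_ex_not => /M_Thm.
by exists [:: j :: v]; rewrite v_F !orbT.
Qed.

Lemma computable_settles :
  computable (fun p : nat * seq (seq nat) => settles p.1 p.2).
Proof.
rewrite /settles; apply: computable_orb; last apply: computable_orb.
- by apply/computable_negb/(computable_comp (@computable_is_code L)); computes.
- apply: computable_mem; first by computes.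
  by apply: (computable_comp (@computable_theorem_codes L C)); computes.
by apply: computable_refutes; computes.
Qed.

Lemma decidable_Thm : decidable_set (Thm C).
Proof.
have onto_nat n : exists x : nat, pickle x = n by exists n.
have onto := pickle_seq_onto (pickle_seq_onto onto_nat).
have [f comp_f f_settles] :=
  computable_search onto computable_settles settles_ex.
have comp_T := computable_comp (@computable_theorem_codes L C) comp_f.
have [g rec_g gE] := computable_mem (computable_id _) comp_T.
exists g => // F; rewrite (gE (formula_code F)).
have: settles (formula_code F) (f (formula_code F)) by apply: f_settles.
rewrite /settles is_code_formula /=.
case: (boolP (_ \in _)) => [/theorem_codes_sound F_thm _|_ /= F_ref].
  by split.
split=> // /M_Thm F_taut.
by have := refutes_not_Taut F_ref (F_taut _).
Qed.

End Decision.

Theorem proposition5p3 (L : language) (C : calculus L) :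
  undecidable C -> ~ approximable C.
Proof.
by move=> undec [M [M_rec _ _ M_Thm]]; apply: undec; apply: decidable_Thm M_Thm.
Qed.
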